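(* Let $d\geq 2$ and let $\varGamma$ be a lattice in $\mathbb{R}^d$. Then $\operatorname{SOC}(\varGamma)$ is a normal subgroup of $\operatorname{SOS}(\varGamma)$, the factor group $\operatorname{SOS}(\varGamma)/\operatorname{SOC}(\varGamma)$ is countable, and it is the direct sum of cyclic groups of prime power orders that divide $d$.
   Context: A lattice in $\mathbb{R}^d$ is a subgroup of the form $\mathbb{Z}b_1\oplus\cdots\oplus\mathbb{Z}b_d$ where $\{b_1,\dots,b_d\}$ is a basis of $\mathbb{R}^d$. Two lattices $\varGamma,\varGamma'$ are commensurate, written $\varGamma\sim\varGamma'$, if $\varGamma\cap\varGamma'$ has finite index both in $\varGamma$ and in $\varGamma'$. $\operatorname{SOC}(\varGamma)=\{R\in\operatorname{SO}(d):\varGamma\sim R\varGamma\}$ is the group of coincidence rotations and $\operatorname{SOS}(\varGamma)=\{R\in\operatorname{SO}(d):\varGamma\sim\alpha R\varGamma\text{ for some }\alpha>0\}$ is the group of similarity rotations; both are subgroups of $\operatorname{SO}(d)$ and $\operatorname{SOC}(\varGamma)\subset\operatorname{SOS}(\varGamma)$. *)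

(* Defs.v *)
From HB Require Import structures.
From mathcomp Require Import all_boot all_order all_algebra.
From mathcomp Require Import reals.
Set Implicit Arguments. Unset Strict Implicit. Unset Printing Implicit Defensive.
Import Order.TTheory GRing.Theory Num.Theory.
Local Open Scope ring_scope.

Section Lat.
Variables (R : realType) (d : nat).

Definition vset := 'cV[R]_d -> Prop.

Definition is_lattice (L : vset) : Prop :=
  exists B : 'M[R]_d, B \in unitmx /\
    forall x, L x <-> exists z : 'cV[int]_d, x = B *m map_mx (fun k : int => k%:~R) z.

Definition setI_v (A B : vset) : vset := fun x => A x /\ B x.

Definition finite_index (H G : vset) : Prop :=
  exists s : seq 'cV[R]_d, (forall y, y \in s -> G y) /\
    forall x, G x -> exists2 y, y \in s & H (x - y).

Definition commensurate (L L' : vset) : Prop :=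
  finite_index (setI_v L L') L /\ finite_index (setI_v L L') L'.

Definition is_rotation (Q : 'M[R]_d) : Prop := Q *m Q^T = 1%:M /\ \det Q = 1.

Definition sim_img (a : R) (Q : 'M[R]_d) (L : vset) : vset :=
  fun x => exists y, L y /\ x = a *: (Q *m y).

Definition rot_img (Q : 'M[R]_d) (L : vset) : vset :=
  fun x => exists y, L y /\ x = Q *m y.

Definition SOC (L : vset) : 'M[R]_d -> Prop :=
  fun Q => is_rotation Q /\ commensurate L (rot_img Q L).

Definition SOS (L : vset) : 'M[R]_d -> Prop :=
  fun Q => is_rotation Q /\ exists a : R, 0 < a /\ commensurate L (sim_img a Q L).

Definition normal_subgroup (N G : 'M[R]_d -> Prop) : Prop :=
  [/\ N 1%:M, (forall P Q, N P -> N Q -> N (P *m Q)),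
      (forall P, N P -> N (invmx P)), (forall Q, N Q -> G Q) &
      (forall S Q, G S -> N Q -> N (S *m Q *m invmx S))].

Definition quotient_countable (N G : 'M[R]_d -> Prop) : Prop :=
  exists f : nat -> 'M[R]_d, (forall n, G (f n)) /\
    forall S, G S -> exists n, N (invmx (f n) *m S).

(* G/N is isomorphic to the direct sum (finitely supported elements of the
   product) of the cyclic groups Z/(n i)Z, i in I, where every n i is a prime
   power p^k (k >= 1) dividing d.  The isomorphism is given as a surjective
   homomorphism phi : G -> (+)_i Z/(n i)Z with kernel N (first isomorphism
   theorem); the i-th component of phi S is an integer read modulo n i. *)
Definition quotient_direct_sum_cyclic (N G : 'M[R]_d -> Prop) : Prop :=
  exists (I : choiceType) (n : I -> nat) (phi : 'M[R]_d -> I -> int),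
  [/\ (forall i, exists p k, [/\ prime p, (0 < k)%N, n i = (p ^ k)%N & (n i %| d)%N]),
      (forall S, G S -> exists s : seq I,
          forall i, i \notin s -> (phi S i = 0 %[mod (n i)%:Z])%Z),
      (forall S T, G S -> G T -> forall i,
          (phi (S *m T) i = phi S i + phi T i %[mod (n i)%:Z])%Z),
      (forall S, G S -> (N S <-> forall i, (phi S i = 0 %[mod (n i)%:Z])%Z)) &
      (forall g : I -> int, (exists s : seq I, forall i, i \notin s -> g i = 0) ->
          exists S, G S /\ forall i, (phi S i = g i %[mod (n i)%:Z])%Z)].

End Lat.

(* Main.v *)
Require Import Defs.
From HB Require Import structures.
From mathcomp Require Import all_boot all_order all_algebra.
From mathcomp Require Import generic_quotient ring_quotient.
From mathcomp Require Import boolp wochoice reals sequences exp.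
Set Implicit Arguments. Unset Strict Implicit. Unset Printing Implicit Defensive.
Import Order.TTheory GRing.Theory Num.Theory.
Local Open Scope ring_scope.
Local Open Scope quotient_scope.

(* For the lattice spanned by the columns of B, a rotation Q is a similarity
   rotation with factor a > 0 iff a B^-1 Q B is rational, and a coincidence
   rotation iff a = 1 is admissible. The factor is unique up to positive rationals,
   so Q |-> log a is a homomorphism from SOS to R / log(Q_{>0}) with kernel SOC.
   Determinants show that a^d is rational, so the image is killed by d; they also
   show that Q is determined by the rational matrix a B^-1 Q B, whence countability.

   An abelian group A with d A = 0 is a direct sum of cyclic groups (Pruefer-Baer).
   For p | d, the socle A[p] is filtered by the A[p] /\ p^j A, and it has a basis
   adapted to this filtration. If b is a basis element of height h, choose a root r
   with p^h r = b. Independence of the b's gives independence of the roots; and if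
   p^(j+1) x = 0, then p^j x lies in A[p] /\ p^j A, hence is p^j times a
   combination of roots, so by induction on the order of x the roots generate A. *)

(** * Abelian groups of bounded exponent *)

(** Used with the pullback of [prec] along a family [b], to pick the last term of a linear
    relation. *)
Lemma seq_max_exists (T : eqType) (r : rel T) (s : seq T) :
  total r -> transitive r -> s != [::] ->
  exists2 m, m \in s & {in s, forall x, r x m}.
Proof.
move=> rtot rtr; elim: s => // x s IH _.
have rr y : r y y by have := rtot y y; rewrite orbb.
case: (eqVneq s [::]) => [->|/IH[m ms hm]].
  by exists x; rewrite ?mem_head // => y; rewrite inE => /eqP->.
have [xm|mx] := orP (rtot x m).
  by exists m; rewrite ?inE ?ms ?orbT // => y; rewrite inE => /predU1P[->|/hm].
exists x; rewrite ?mem_head // => y; rewrite inE => /predU1P[->//|/hm ym].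
exact: rtr ym mx.
Qed.

(** * Subgroups and generated subgroups of an abelian group *)

Section Span.
Variable A : zmodType.
Implicit Types (K P Q : A -> Prop).

Definition subgroup K := K 0 /\ forall x y, K x -> K y -> K (x - y).

Lemma subgroupN K x : subgroup K -> K x -> K (- x).
Proof. by case=> K0 KB Kx; rewrite -sub0r; exact: KB. Qed.

Lemma subgroupD K x y : subgroup K -> K x -> K y -> K (x + y).
Proof.
by move=> sK Kx Ky; rewrite -[y]opprK; apply: sK.2 => //; apply: subgroupN.
Qed.

Lemma subgroup_sum K (J : eqType) (s : seq J) (F : J -> A) : subgroup K ->
  {in s, forall i, K (F i)} -> K (\sum_(i <- s) F i).
Proof.
move=> sK KF; rewrite big_seq; elim/big_ind: _ => //; first exact: sK.1.
by move=> x y; exact: subgroupD.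
Qed.

Lemma subgroupMz K x c : subgroup K -> K x -> K (x *~ c).
Proof.
move=> sK Kx; have Kn n : K (x *+ n).
  elim: n => [|n IH]; first by rewrite mulr0n; exact: sK.1.
  by rewrite mulrS; exact: subgroupD.
by case: c => n; [exact: Kn|rewrite NegzE mulrNz; apply: subgroupN => //; exact: Kn].
Qed.

Lemma subgroupMn K x n : subgroup K -> K x -> K (x *+ n).
Proof. exact: (@subgroupMz K x n). Qed.

(** Intersection of all subgroups containing [P]: a membership proof then acts as an induction
    principle, applied directly to the subgroup that is to contain the element. *)
Definition span P x := forall K, subgroup K -> (forall y, P y -> K y) -> K x.

Lemma span_subgroup P : subgroup (span P).
Proof.
split=> [K [K0 _] _ //|x y sx sy K sK PK].
by apply: sK.2; [exact: sx|exact: sy].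
Qed.

Lemma span0 P : span P 0.
Proof. exact: (span_subgroup P).1. Qed.

Lemma span_gen P x : P x -> span P x.
Proof. by move=> Px K _; exact. Qed.

End Span.

(** * The p-socle, its height filtration and an adapted basis *)

Section Socle.
Variables (A : zmodType) (d p : nat).
Hypotheses (d_gt0 : (0 < d)%N) (dA0 : forall x : A, x *+ d = 0).
Hypotheses (p_pr : prime p) (pd : (p %| d)%N).
Implicit Types x y b : A.

Lemma logn_exponent_gt0 : (0 < logn p d)%N.
Proof. by rewrite logn_gt0 mem_primes p_pr d_gt0. Qed.

(** The search stops below v_p(d), so that 0 too has a finite height, namely v_p(d) - 1. *)
Definition height (x : A) : nat :=
  \max_(j < logn p d | `[< exists y, x = y *+ p ^ j >]) j.

Lemma height_ltn x : (height x < logn p d)%N.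
Proof.
rewrite /height; elim/big_ind: _ => [|i j hi hj|i _].
- exact: logn_exponent_gt0.
- by rewrite gtn_max hi hj.
- exact: ltn_ord.
Qed.

Lemma height_divisible x : exists y, x = y *+ p ^ height x.
Proof.
rewrite /height; elim/big_ind: _ => [|i j hi hj|i /asboolP //].
  by exists x; rewrite expn0 mulr1n.
by rewrite /maxn; case: ifP.
Qed.

Lemma gcd_torsion x m n :
  (0 < m)%N -> x *+ m = 0 -> x *+ n = 0 -> x *+ gcdn m n = 0.
Proof.
move=> m0 xm xn; case: (egcdnP n m0) => u v E _.
have := mulrnA x m u; rewrite mulnC E addnC mulrnDr mulnC mulrnA.
by rewrite xn mul0rn addr0 xm mul0rn.
Qed.

(** If j >= v_p(d), then y is killed by d and by p^(j+1), hence by their gcd, which divides p^j; so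
    x = 0. Truncating the height therefore loses nothing on nonzero socle elements. *)
Lemma leq_height x y j : x != 0 -> x *+ p = 0 -> x = y *+ p ^ j ->
  (j <= height x)%N.
Proof.
move=> x0 xp xy; case: (ltnP j (logn p d)) => jk.
  rewrite /height (bigD1 (Ordinal jk)) /= ?leq_maxl //.
  by apply/asboolP; exists y.
case/eqP: x0; rewrite xy; have yz : y *+ p ^ j.+1 = 0 by rewrite expnSr mulrnA -xy.
have := gcd_torsion d_gt0 (dA0 y) yz.
suff /dvdnP[q ->] : (gcdn d (p ^ j.+1) %| p ^ j)%N.
  by rewrite mulnC mulrnA => ->; rewrite mul0rn.
rewrite gcdnC; have /dvdn_pfactor: (gcdn (p ^ j.+1) d %| p ^ j.+1)%N by rewrite dvdn_gcdl.
case=> // e _ E; rewrite E dvdn_exp2l //; apply: leq_trans jk.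
by rewrite -(pfactorK e p_pr) -E dvdn_leq_log // dvdn_gcdr.
Qed.

Let wo := sval (well_ordering_principle A).
Let wo_wo : well_order wo := svalP (well_ordering_principle A).

Lemma wo_chain_predT : @wo_chain A wo predT.
Proof. by move=> X _; exact: wo_wo. Qed.

(* Larger height comes first, ties being broken by the well-order: a basis
   extracted along this order is adapted to the filtration of the socle by the
   subgroups [p^j A]. *)
Definition prec x y :=
  ((height y < height x) || (height x == height y) && wo x y)%N.

Lemma wo_total : total wo.
Proof. by move=> x y; apply: (wo_chainW wo_chain_predT). Qed.

(** Take the least element of {x, y, z}: if it is y or z, antisymmetry identifies two of the three
    points. *)
Lemma wo_trans : transitive wo.
Proof.
move=> y x z xy yz.
pose X := [pred t | [|| t == x, t == y | t == z]].
have [|m [[Xm mX] _]] := @wo_wo X; first by exists x; rewrite !inE eqxx.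
have anti := wo_chain_antisymmetric wo_chain_predT.
have [mx my mz] : [/\ wo m x, wo m y & wo m z].
  by split; apply: mX; rewrite !inE eqxx ?orbT.
case/or3P: Xm => /eqP E; subst m => //.
  by rewrite (anti x y) // xy mx.
by rewrite -(anti y z) // yz my.
Qed.

Lemma prec_total : total prec.
Proof.
move=> x y; rewrite /prec; case: ltngtP => //= _; exact: wo_total.
Qed.

Lemma prec_trans : transitive prec.
Proof.
move=> y x z; rewrite /prec.
case/orP=> [yx|/andP[/eqP-> xy]]; case/orP=> [zy|/andP[/eqP<- yz]].
- by rewrite (ltn_trans zy).
- by rewrite yx.
- by rewrite zy.
- by rewrite eqxx (wo_trans xy yz) orbT.
Qed.

Lemma prec_height x y : prec x y -> (height y <= height x)%N.
Proof. by rewrite /prec => /orP[/ltnW|/andP[/eqP->]]. Qed.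

(** Heights are bounded, so a largest one occurs in [X]; among the elements of that height the
    well-order has a least one. *)
Lemma prec_min_exists (X : A -> Prop) :
  (exists x, X x) -> exists2 m, X m & forall y, X y -> prec m y.
Proof.
case=> x0 X0.
pose H h := `[< exists2 x, X x & height x = h >].
have exH : exists h, H h by exists (height x0); apply/asboolP; exists x0.
have bH h : H h -> (h <= logn p d)%N.
  by move=> /asboolP[x _ <-]; exact/ltnW/height_ltn.
case: (ex_maxnP exH bH) => h /asboolP[x Xx hx] maxh.
pose Xh := [pred y | `[< X y /\ height y = h >]].
have [|m [[/asboolP[Xm hm] mX] _]] := wo_wo (A := Xh).
  by exists x; apply/asboolP.
exists m => // y Xy; rewrite /prec hm.
have : (height y <= h)%N by apply: maxh; apply/asboolP; exists y.
rewrite leq_eqVlt => /orP[/eqP hy|-> //].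
by rewrite hy eqxx mX ?orbT // inE; apply/asboolP.
Qed.

(** Greedy choice of an F_p-basis of A[p] along [prec], by an explicit criterion instead of Zorn's
    lemma. *)
Definition socle_basis x :=
  x *+ p = 0 /\ ~ span (fun y => [/\ y *+ p = 0, prec y x & y <> x]) x.

(** A [prec]-least counterexample m is not a basis element, so strictly earlier socle elements
    generate it; these are no counterexamples and have height at least that of m. The height bound
    is what makes the basis adapted to the filtration. *)
Lemma socle_basis_span x : x *+ p = 0 ->
  span (fun b => socle_basis b /\ (height x <= height b)%N) x.
Proof.
apply: contrapT => nx.
pose bad y := y *+ p = 0 /\
  ~ span (fun b => socle_basis b /\ (height y <= height b)%N) y.
case: (@prec_min_exists bad) => [|m [mp nm] mmin].
  by exists x; split; [apply: contrapT => h|move=> h]; apply: nx.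
apply: nm => K sK KB.
case: (pselect (socle_basis m)) => [bm|nb]; first by apply: KB.
have sm : span (fun y => [/\ y *+ p = 0, prec y m & y <> m]) m.
  by apply: contrapT => h; apply: nb.
apply: sm => // y [yp ym nym].
case: (pselect (bad y)) => [/mmin my|].
  exfalso; apply: nym; move: ym my; rewrite /prec.
  case: ltngtP => //= _ ym my.
  by apply: (wo_chain_antisymmetric wo_chain_predT); rewrite ?inE // ym my.
move=> ngood.
have : span (fun b => socle_basis b /\ (height y <= height b)%N) y.
  by apply: contrapT => h; apply: ngood.
apply=> // b [bb hb]; apply: KB; split=> //.
exact: leq_trans (prec_height ym) hb.
Qed.

Lemma mulrz_dvd0 (x : A) n (c : int) : x *+ n = 0 -> (n %| c)%Z -> x *~ c = 0.
Proof. by move=> xn /dvdzP[q ->]; rewrite mulrC mulrzA -pmulrn xn mul0rz. Qed.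

(* In a relation with a coefficient prime to p, the last such term would lie in
   the span of its predecessors. *)
Lemma socle_basis_free (J : eqType) (s : seq J) (b : J -> A) (c : J -> int) :
  uniq s -> {in s &, injective b} -> {in s, forall i, socle_basis (b i)} ->
  \sum_(i <- s) b i *~ c i = 0 -> {in s, forall i, (p %| c i)%Z}.
Proof.
move=> us binj bs S0 i0 i0s; apply: contraT => nd.
pose s' := [seq i <- s | ~~ (p %| c i)%Z].
have i0s' : i0 \in s' by rewrite mem_filter nd.
have ne : s' != [::] by apply/eqP => E; rewrite E in i0s'.
have [|||m] := @seq_max_exists J (fun i j => prec (b i) (b j)) s' => //.
- by move=> i j; exact: prec_total.
- by move=> j i k; exact: prec_trans.
rewrite mem_filter => /andP[ncm ms] mmax.
have [bmp []] := bs m ms.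
(* Here u inverts c m modulo p, so it suffices to put [b m *~ c m] in the span; the relation
   expresses it by the other terms. *)
have [u [v uv]] := Bezoutz (c m) p.
have cop : gcdz (c m) p = 1.
  by move: ncm; rewrite dvdzE -prime_coprime // coprime_sym /gcdz => /eqP->.
have bmE : b m = b m *~ c m *~ u.
  have := mulr1z (b m); rewrite -{1}cop -uv mulrzDr [u * _]mulrC [v * _]mulrC.
  by rewrite !mulrzA -!pmulrn bmp mul0rz addr0 => ->.
rewrite [X in span _ X]bmE.
have -> : b m *~ c m = - \sum_(i <- s | i != m) b i *~ c i.
  by apply/eqP; rewrite -addr_eq0 -(bigD1_seq m) ?S0.
apply: (subgroupMz _ (span_subgroup _)); apply: (subgroupN (span_subgroup _)).
rewrite -big_filter; apply: subgroup_sum; first exact: span_subgroup.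
move=> i; rewrite mem_filter => /andP[im is_].
(* A term with p | c i vanishes; any other one precedes b m by the choice of m. *)
case: (boolP (p %| c i)%Z) => ci.
  by rewrite (mulrz_dvd0 (bs i is_).1) //; exact: span0.
apply: (subgroupMz _ (span_subgroup _)); apply: span_gen; split.
- exact: (bs i is_).1.
- by apply: mmax; rewrite mem_filter ci.
- by move=> /(binj _ _ is_ ms) /eqP; rewrite (negPf im).
Qed.

Definition socle_root x := projT1 (cid (height_divisible x)).

Lemma socle_rootE x : socle_root x *+ p ^ height x = x.
Proof. by rewrite -(projT2 (cid (height_divisible x))). Qed.

Lemma socle_root_torsion x : x *+ p = 0 -> socle_root x *+ p ^ (height x).+1 = 0.
Proof. by move=> xp; rewrite expnSr mulrnA socle_rootE. Qed.

Lemma socle_root_free (J : eqType) (s : seq J) (b : J -> A) (c : J -> int) :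
  uniq s -> {in s &, injective b} -> {in s, forall i, socle_basis (b i)} ->
  \sum_(i <- s) socle_root (b i) *~ c i = 0 ->
  {in s, forall i, ((p ^ (height (b i)).+1)%N %| c i)%Z}.
Proof.
move=> us binj bs S0.
(* The valuations are raised one at a time: if [p^(r+1) c_i] is divisible by
   [p^(h_i+1)] for all i, then [p^r c_i = p^h_i u_i], and multiplying the relation
   by [p^r] gives a relation between the [b_i] with coefficients [u_i]. *)
suff H t : {in s, forall i,
    ((p ^ (height (b i)).+1)%N %| (p ^ (logn p d - t))%N%:Z * c i)%Z}.
  by move=> i is_; have := H (logn p d) i is_; rewrite subnn expn0 mul1r.
elim: t => [|t IH].
  by move=> i _; rewrite subn0 dvdz_mulr // dvdzE /= dvdn_exp2l // height_ltn.
(* Once the exponent has reached 0, the claim for t + 1 is the claim for t. *)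
rewrite subnS; case E : (logn p d - t)%N => [|r] /=; first by rewrite -E.
rewrite {}E in IH.
have {}IH i : i \in s -> ((p ^ height (b i))%N %| (p ^ r)%N%:Z * c i)%Z.
  move=> /IH; rewrite !expnS !PoszM -mulrA dvdz_mul2l //.
  by rewrite -lt0n prime_gt0.
pose u i := ((p ^ r)%N%:Z * c i %/ (p ^ height (b i))%N)%Z.
have uE i : i \in s -> (p ^ r)%N%:Z * c i = u i * (p ^ height (b i))%N.
  by move=> is_; rewrite /u divzK // IH.
have U0 : \sum_(i <- s) b i *~ u i = 0.
  transitivity ((\sum_(i <- s) socle_root (b i) *~ c i) *~ (p ^ r)%N); last first.
    by rewrite S0 mul0rz.
  rewrite -pmulrn -sumrMnl big_seq [RHS]big_seq; apply: eq_bigr => i is_.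
  by rewrite pmulrn -mulrzA [c i * _]mulrC uE // mulrC mulrzA -pmulrn socle_rootE.
move=> i is_; rewrite uE // expnS PoszM dvdz_mul //.
exact: (socle_basis_free us binj bs U0).
Qed.

End Socle.

(** * Direct sum decomposition of a group of bounded exponent *)

Section PruferBaer.
Variables (A : zmodType) (d : nat).
Hypotheses (d_gt0 : (0 < d)%N) (dA0 : forall x : A, x *+ d = 0).

(** Strong induction on an exponent m = p m' of x. The socle element m' x is also m' times some
    element of C; subtracting that element from x leaves something killed by m'. *)
Lemma socle_root_generate (C : A -> Prop) : subgroup C ->
  (forall p b, prime p -> (p %| d)%N -> socle_basis d p b ->
    C (socle_root d p b)) ->
  forall x, C x.
Proof.
move=> sC CR.
suff H n m x : (m < n)%N -> (m %| d)%N -> x *+ m = 0 -> C x.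
  by move=> x; exact: (H d.+1 d).
elim: n m x => // n IH m x; rewrite ltnS => le_mn md xm.
have m_gt0 := dvdn_gt0 d_gt0 md.
case: (ltnP 1 m) => [m1|]; last first.
  move=> m1; have m1' : m = 1%N by apply/eqP; rewrite eqn_leq m1 m_gt0.
  by move: xm; rewrite m1' mulr1n => ->; exact: sC.1.
have p_pr := pdiv_prime m1; set p := pdiv m in p_pr.
have pm : (p %| m)%N := pdiv_dvd m.
have pd := dvdn_trans pm md.
case/dvdnP: pm => m1' mE.
have m'0 : (0 < m1')%N by move: m_gt0; rewrite mE; case: m1' {mE}.
have IHm y : y *+ m1' = 0 -> C y.
  move=> ym; apply: (IH m1') => //.
    by rewrite (leq_trans _ le_mn) // mE ltn_Pmulr ?prime_gt1.
  by apply: dvdn_trans md; rewrite mE dvdn_mulr.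
have [y0|y0] := eqVneq (x *+ m1') 0; first exact: IHm.
have [m2 cop m2E] := pfactor_coprime p_pr m'0.
set j := logn p m1' in m2E.
(* The p-power torsion of z is recorded because it makes m2, prime to p, invertible on z. *)
pose K w := exists z, [/\ C z, z *+ p ^ logn p d = 0 & w = z *+ p ^ j].
have sK : subgroup K.
  split; first by exists 0; split; rewrite ?mul0rn //; exact: sC.1.
  move=> _ _ [z [Cz z0 ->]] [t [Ct t0 ->]]; exists (z - t).
  by split; rewrite ?mulrnBl ?z0 ?t0 ?subr0 //; exact: sC.2.
have yp : x *+ m1' *+ p = 0 by rewrite -mulrnA -mE.
(* [x m1'] lies in the socle and in [p^j A], hence in the span of the basis
   elements of height at least j, each of which is [p^j] times an element of C. *)
have [z [Cz z0 yz]] : K (x *+ m1').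
  apply: (socle_basis_span d_gt0 p_pr pd yp) => // b [bb hb].
  have jb : (j <= height d p b)%N.
    apply: leq_trans hb; apply: (leq_height d_gt0 dA0 p_pr y0 yp (y := x *+ m2)).
    by rewrite -mulrnA -m2E.
  exists (socle_root d p b *+ p ^ (height d p b - j)); split.
  - by apply: subgroupMn => //; exact: CR.
  - rewrite -mulrnA -expnD.
    have /subnK <- : ((height d p b).+1 <= height d p b - j + logn p d)%N.
      by rewrite (leq_trans (height_ltn d_gt0 p_pr pd b)) // leq_addl.
    by rewrite addnC expnD mulrnA socle_root_torsion ?mul0rn //; case: bb.
  - by rewrite -mulrnA -expnD subnK // socle_rootE.
(* With u an inverse of m2 modulo p^(v_p(d)), multiplying u z by m' = m2 p^j gives p^j z = m' x. *)
have [u [v uv]] := Bezoutz m2 (p ^ logn p d)%N.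
have cop1 : gcdz m2 (p ^ logn p d)%N = 1.
  by apply/eqP; rewrite /gcdz /= eqz_nat -/(coprime _ _) coprime_sym coprimeXl.
have zE : z *~ u *+ m1' = x *+ m1'.
  rewrite yz m2E mulrnA; congr (_ *+ _).
  have := mulr1z z; rewrite -{1}cop1 -uv mulrzDr [v * _]mulrC !mulrzA.
  by rewrite -!pmulrn z0 mul0rz addr0.
rewrite -[x](subrK (z *~ u)); apply: subgroupD => //; last exact: subgroupMz.
by apply: IHm; rewrite mulrnBl zE subrr.
Qed.

(** Storing the prime with the basis element lets one index type serve all primes dividing d; the
    boolean predicate makes it a subtype with a choice structure. *)
Definition cyclic_index : Type :=
  {i : nat * A | `[< [/\ prime i.1, (i.1 %| d)%N & socle_basis d i.1 i.2] >]}.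
HB.instance Definition _ := Choice.on cyclic_index.

Implicit Types (i : cyclic_index) (s : seq cyclic_index).

Lemma cyclic_indexP i : 
  [/\ prime (val i).1, ((val i).1 %| d)%N & socle_basis d (val i).1 (val i).2].
Proof. exact/asboolP/(valP i). Qed.

Definition cyclic_order i := ((val i).1 ^ (height d (val i).1 (val i).2).+1)%N.
Definition cyclic_generator i := socle_root d (val i).1 (val i).2.

Lemma cyclic_order_dvd i : (cyclic_order i %| d)%N.
Proof.
have [p_pr pd _] := cyclic_indexP i.
by rewrite pfactor_dvdn // height_ltn.
Qed.

Lemma cyclic_generator_torsion i : cyclic_generator i *+ cyclic_order i = 0.
Proof. by have [_ _ [xp _]] := cyclic_indexP i; exact: socle_root_torsion. Qed.

Lemma cyclic_generator_free s (c : cyclic_index -> int) : uniq s ->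
  \sum_(i <- s) cyclic_generator i *~ c i = 0 ->
  {in s, forall i, (cyclic_order i %| c i)%Z}.
Proof.
move=> us S0 i0 i0s; have [p_pr pd _] := cyclic_indexP i0.
set p := (val i0).1 in p_pr pd.
have [m cop dE] := pfactor_coprime p_pr d_gt0.
(* Multiplication by the prime-to-p part m of d kills the other primes. *)
pose s' := [seq i <- s | (val i).1 == p].
have S1 : \sum_(i <- s') socle_root d p (val i).2 *~ (m%:Z * c i) = 0.
  transitivity ((\sum_(i <- s) cyclic_generator i *~ c i) *+ m); last first.
    by rewrite S0 mul0rn.
  rewrite -sumrMnl big_filter big_mkcond /=; apply: eq_bigr => i _.
  case: eqP => [ip|/eqP ip].
    by rewrite mulrC mulrzA -pmulrn /cyclic_generator ip.
  rewrite pmulrn -mulrzA mulrC (mulrz_dvd0 (cyclic_generator_torsion i)) //.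
  rewrite dvdz_mulr // dvdzE /= -(@Gauss_dvdl _ _ (p ^ logn p d)) -?dE.
    exact: cyclic_order_dvd.
  have [q_pr _ _] := cyclic_indexP i.
  by rewrite coprimeXl // coprimeXr // prime_coprime // dvdn_prime2.
have us' : uniq s' by rewrite filter_uniq.
have binj : {in s' &, injective (fun i => (val i).2)}.
  move=> i j; rewrite !mem_filter => /andP[/eqP ip _] /andP[/eqP jp _] E.
  by apply/val_inj/eqP; rewrite -pair_eqE /pair_eq /= ip jp E !eqxx.
have bs : {in s', forall i, socle_basis d p (val i).2}.
  move=> i; rewrite mem_filter => /andP[/eqP <- _].
  by have [] := cyclic_indexP i.
have := socle_root_free d_gt0 p_pr pd us' binj bs S1 (x := i0).
rewrite mem_filter eqxx i0s => /(_ isT); rewrite Gauss_dvdzr //.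
by rewrite /coprimez /gcdz /= eqz_nat -/(coprime _ _) coprimeXl.
Qed.

(** Coefficients are functions on all indices, vanishing off [s], so that combinations with
    different supports can be subtracted pointwise. *)
Definition combination (x : A) (c : cyclic_index -> int) :=
  exists2 s, uniq s & (forall i, i \notin s -> c i = 0) /\
    x = \sum_(i <- s) cyclic_generator i *~ c i.

(** Both sums are first extended by zero terms to the union of the two supports. *)
Lemma combinationB x y c e : combination x c -> combination y e ->
  combination (x - y) (fun i => c i - e i).
Proof.
have widen s t (f : cyclic_index -> int) : uniq s -> uniq t -> {subset s <= t} ->
    (forall i, i \notin s -> f i = 0) ->
    \sum_(i <- s) cyclic_generator i *~ f i =
    \sum_(i <- t) cyclic_generator i *~ f i.
  move=> us ut st f0; rewrite (bigID (mem s) _ (r := t)) /=.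
  rewrite [X in _ + X]big1 => [|i /f0->].
    rewrite addr0 -[RHS]big_filter; apply: perm_big; apply: uniq_perm => //.
      by rewrite filter_uniq.
    by move=> i; rewrite mem_filter; case: (boolP (i \in s)) => //= /st.
  by rewrite mulr0z.
move=> [s us [cs ->]] [t ut [et ->]].
exists (undup (s ++ t)); first exact: undup_uniq.
split=> [i|].
  by rewrite mem_undup mem_cat negb_or => /andP[/cs-> /et->].
rewrite (widen s (undup (s ++ t))) ?undup_uniq //; last first.
  by move=> i; rewrite mem_undup mem_cat => ->.
rewrite (widen t (undup (s ++ t))) ?undup_uniq //; last first.
  by move=> i; rewrite mem_undup mem_cat => ->; rewrite orbT.
by rewrite -sumrB; apply: eq_bigr => i _; rewrite mulrzBr.
Qed.

Lemma combination_exists x : exists c, combination x c.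
Proof.
apply: (@socle_root_generate (fun x => exists c, combination x c)).
  split; first by exists (fun=> 0), [::] => //; rewrite big_nil.
  move=> y z [c yc] [e ze]; exists (fun i => c i - e i); exact: combinationB.
move=> p b p_pr pd bb.
have ib : `[< [/\ prime p, (p %| d)%N & socle_basis d p b] >] by exact/asboolP.
pose i : cyclic_index := exist _ (p, b) ib.
exists (fun j => (j == i)%:Z), [:: i] => //; split=> [j|].
  by rewrite inE => /negPf->.
by rewrite big_seq1 eqxx mulr1z.
Qed.

Lemma combination0 c i : combination 0 c -> (cyclic_order i %| c i)%Z.
Proof.
case=> s us [c0 /esym S0]; case: (boolP (i \in s)) => [|/c0->]; last exact: dvdz0.
exact: (cyclic_generator_free us S0).
Qed.

(** The generators determine coefficients only modulo their orders, so [phi] picks integer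
    representatives and its laws are congruences. *)
Theorem bounded_group_direct_sum_cyclic :
  exists (I : choiceType) (n : I -> nat) (phi : A -> I -> int),
  [/\ (forall i : I, exists p k,
          [/\ prime p, (0 < k)%N, n i = (p ^ k)%N & (n i %| d)%N]),
      (forall x, exists s : seq I, forall i : I, i \notin s -> phi x i = 0),
      (forall x y (i : I), (phi (x + y) i = phi x i + phi y i %[mod (n i)%:Z])%Z),
      (forall x, (forall i : I, (phi x i = 0 %[mod (n i)%:Z])%Z) -> x = 0) &
      (forall g : I -> int, (exists s : seq I, forall i : I, i \notin s -> g i = 0) ->
          exists x, forall i : I, (phi x i = g i %[mod (n i)%:Z])%Z)].
Proof.
pose phi x := projT1 (cid (combination_exists x)).
have phiP x : combination x (phi x) := projT2 (cid (combination_exists x)).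
have phi_uniq x c i : combination x c -> (phi x i = c i %[mod (cyclic_order i)%:Z])%Z.
  move=> xc; apply/eqP; rewrite eqz_mod_dvd.
  apply: (@combination0 (fun i => phi x i - c i)).
  by rewrite -(subrr x); exact: combinationB.
exists cyclic_index, cyclic_order, phi; split.
- move=> i; have [p_pr pd _] := cyclic_indexP i.
  exists (val i).1, (height d (val i).1 (val i).2).+1; split=> //.
  exact: cyclic_order_dvd.
- by move=> x; have [s _ [s0 _]] := phiP x; exists s.
(* Additivity is read off from x = (x + y) - y, as combinations are closed under subtraction. *)
- move=> x y i; have := combinationB (phiP (x + y)) (phiP y).
  rewrite addrK => /phi_uniq xE; have := xE i.
  move/eqP; rewrite eqz_mod_dvd opprB addrA => h.
  by apply/esym/eqP; rewrite eqz_mod_dvd.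
- move=> x h; have [s _ [_ ->]] := phiP x; apply: big1 => i _.
  apply: (mulrz_dvd0 (cyclic_generator_torsion i)).
  by rewrite -[phi x i]subr0 -eqz_mod_dvd; apply/eqP; exact: h.
- move=> g [s gs]; exists (\sum_(i <- undup s) cyclic_generator i *~ g i) => i.
  apply: phi_uniq; exists (undup s); first exact: undup_uniq.
  by split=> // j; rewrite mem_undup => /gs.
Qed.

End PruferBaer.

(** * Commensurability of lattices and rational matrices *)

Section LatticeCommensurability.
Variables (R : realType) (d : nat).
Implicit Types (B C Q : 'M[R]_d) (M : 'M[rat]_d).

Definition lattice_of B : vset R d :=
  fun x => exists z : 'cV[int]_d, x = B *m map_mx intr z.

Lemma is_lattice_lattice_of (L : vset R d) :
  is_lattice L -> exists2 B, B \in unitmx & L = lattice_of B.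
Proof.
by case=> B [Bu LB]; exists B => //; apply/funext => x; apply/propext; exact: LB.
Qed.

Lemma rat_mx_denominator M : exists2 q : nat, (0 < q)%N &
  exists Z : 'M[int]_d, q%:R *: map_mx (ratr : rat -> R) M = map_mx intr Z.
Proof.
pose q := (\prod_(ij : 'I_d * 'I_d) `|denq (M ij.1 ij.2)|)%N.
have q_gt0 : (0 < q)%N by rewrite prodn_gt0 // => ij; rewrite absz_gt0 denq_neq0.
exists q => //.
exists (\matrix_(i, j) (numq (M i j) * (q %/ `|denq (M i j)|)%N%:Z)).
apply/matrixP => i j; rewrite !mxE /ratr.
have dq : (`|denq (M i j)| %| q)%N by rewrite /q (bigD1 (i, j)) //= dvdn_mulr.
have dE : `|denq (M i j)|%:R = (denq (M i j))%:~R :> R.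
  by rewrite pmulrn absz_denq.
rewrite rmorphM /= -[in LHS](divnK dq) natrM dE -pmulrn mulrCA -mulrA.
rewrite divff ?mulr1.
  by rewrite mulrC.
by rewrite intr_eq0 denq_neq0.
Qed.

(** [H] contains q times the lattice, so the vectors with coordinates in {0, ..., q-1} represent all
    classes. *)
Lemma finite_index_lattice_of (H : vset R d) C q : (0 < q)%N ->
  (forall w : 'cV[int]_d, H (q%:R *: (C *m map_mx intr w))) ->
  finite_index H (lattice_of C).
Proof.
case: q => // q _ HC.
pose rep (r : 'cV['I_q.+1]_d) :=
  C *m map_mx intr (map_mx (fun k : 'I_q.+1 => k%:Z) r).
exists [seq rep r | r <- enum {: 'cV['I_q.+1]_d}]; split.
  by move=> _ /mapP[r _ ->]; eexists.
move=> _ [z ->].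
pose r : 'cV['I_q.+1]_d := \matrix_(i, j) inord `|(z i j %% q.+1)%Z|.
exists (rep r); first by rewrite map_f // mem_enum.
suff -> : C *m map_mx intr z - rep r =
    q.+1%:R *: (C *m map_mx intr (\matrix_(i, j) (z i j %/ q.+1)%Z)) by exact: HC.
rewrite /rep -mulmxBr scalemxAr; congr (C *m _).
apply/matrixP => i j; rewrite !mxE.
have zq0 : 0 <= (z i j %% q.+1)%Z by rewrite modz_ge0.
rewrite inordK; last by rewrite -ltz_nat gez0_abs // ltz_pmod.
rewrite gez0_abs // {1}(divz_eq (z i j) q.+1) -rmorphB /= addrK rmorphM /= mulrC.
by rewrite -pmulrn.
Qed.

(** If B1 = C1 M1 and q clears the denominators of M1, then q times the lattice of B1 lies in both
    lattices. This applies to M and to its inverse. *)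
Lemma commensurate_lattice_of B C M : M \in unitmx -> C = B *m map_mx ratr M ->
  commensurate (lattice_of B) (lattice_of C).
Proof.
move=> Mu CE.
have half B1 C1 M1 : B1 = C1 *m map_mx ratr M1 ->
    finite_index (setI_v (lattice_of B1) (lattice_of C1)) (lattice_of B1).
  move=> BE; have [q q0 [Z ZE]] := rat_mx_denominator M1.
  apply: (finite_index_lattice_of q0) => w; split.
    by exists (q%:Z *: w); rewrite map_mxZ /= scalemxAr -pmulrn.
  exists (Z *m w); rewrite BE map_mxM -ZE /=.
  by rewrite -!scalemxAl -!scalemxAr mulmxA.
split.
  apply: (half _ _ (invmx M)).
  by rewrite CE -mulmxA -map_mxM mulmxV // map_mx1 mulmx1.
have [s [sC sH]] := half _ _ _ CE.
exists s; split=> // x /sH[y ys [h1 h2]].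
by exists y => //; split.
Qed.

(* Pigeonhole on the classes of [0, y, 2 y, ...]. *)
Lemma finite_index_multiple (H G : vset R d) y :
  (forall x z, H x -> H z -> H (x - z)) -> finite_index H G ->
  (forall n : nat, G (n%:R *: y)) -> exists2 n : nat, (0 < n)%N & H (n%:R *: y).
Proof.
move=> HB [s [_ sH]] Gy.
pose f (t : 'I_(size s).+1) : 'cV[R]_d := s2val (cid2 (sH _ (Gy t))).
have fs t : f t \in s := s2valP (cid2 (sH _ (Gy t))).
have Hf (t : 'I_(size s).+1) : H (t%:R *: y - f t) := s2valP' (cid2 (sH _ (Gy t))).
pose g t : 'I_(size s) := Ordinal (etrans (index_mem _ _) (fs t)).
have /injectivePn[t [u tu gE]] : ~~ injectiveb g.
  by apply/injectiveP => /leq_card; rewrite !card_ord ltnn.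
have fE : f t = f u.
  have iE : index (f t) s = index (f u) s := congr1 val gE.
  by rewrite -(nth_index 0 (fs t)) -(nth_index 0 (fs u)) iE.
wlog ltu : t u tu gE fE / (t < u)%N.
  move=> h; have := tu; rewrite neq_ltn => /orP[lt|lt]; first exact: (h t u).
  by apply: (h u t) => //; rewrite eq_sym.
exists (u - t)%N; first by rewrite subn_gt0.
have := HB _ _ (Hf u) (Hf t).
by rewrite fE opprB addrA subrK natrB ?(ltnW ltu) // scalerBl.
Qed.

(** Some positive multiple n of each column of C lies in the lattice of B; its integer coordinates
    divided by n form a column of M. *)
Lemma commensurate_lattice_of_rat B C : B \in unitmx -> C \in unitmx ->
  commensurate (lattice_of B) (lattice_of C) ->
  exists2 M, M \in unitmx & C = B *m map_mx ratr M.
Proof.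
move=> Bu Cu [_ fi].
have col_mult j : exists nz : nat * 'cV[int]_d,
    (0 < nz.1)%N /\ nz.1%:R *: col j C = B *m map_mx intr nz.2.
  have [||n n0 [[z zE] _]] := finite_index_multiple (y := col j C) _ fi.
  - move=> x y [[a ->] [b xE]] [[a' ->] [b' yE]]; split.
      by exists (a - a'); rewrite map_mxB mulmxBr.
    by exists (b - b'); rewrite map_mxB mulmxBr xE yE.
  - move=> n; exists (n%:Z *: delta_mx j 0).
    by rewrite map_mxZ map_delta_mx /= -scalemxAr colE -pmulrn.
  by exists (n, z).
pose nz j := projT1 (cid (col_mult j)).
have nzP j : (0 < (nz j).1)%N /\
    (nz j).1%:R *: col j C = B *m map_mx intr (nz j).2.
  exact: projT2 (cid (col_mult j)).
pose M : 'M[rat]_d := \matrix_(i, j) (((nz j).2 i 0)%:~R / (nz j).1%:R).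
have CE : C = B *m map_mx ratr M.
  apply/matrixP => i j; have [n0 nE] := nzP j.
  have n0' : (nz j).1%:R != 0 :> R by rewrite pnatr_eq0 -lt0n.
  apply: (mulfI n0'); have /matrixP/(_ i 0) := nE.
  rewrite !mxE => ->; rewrite mulr_sumr; apply: eq_bigr => k _.
  rewrite !mxE fmorph_div /= ratr_int ratr_nat mulrCA; congr (_ * _).
  by rewrite mulrC divfK.
exists M => //.
by move: Cu; rewrite CE unitmx_mul Bu -(map_unitmx (ratr : rat -> R)).
Qed.

(** * Rational similarities: commensurability with a scaled rotated copy *)

Lemma sim_img_lattice_of a Q B :
  sim_img a Q (lattice_of B) = lattice_of (a *: (Q *m B)).
Proof.
apply/funext => x; apply/propext; split=> [[_ [[z ->] ->]]|[z ->]].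
  by exists z; rewrite -scalemxAl mulmxA.
by exists (B *m map_mx intr z); split; [exists z|rewrite -scalemxAl mulmxA].
Qed.

Lemma rot_imgE Q (L : vset R d) : rot_img Q L = sim_img 1 Q L.
Proof.
by apply/funext => x; apply/propext; split=> -[y [Ly ->]]; exists y; rewrite scale1r.
Qed.

Definition rational_similarity B (a : R) Q :=
  exists2 M, M \in unitmx & a *: (Q *m B) = B *m map_mx ratr M.

Lemma commensurate_sim_img B a Q : B \in unitmx -> Q \in unitmx -> a != 0 ->
  commensurate (lattice_of B) (sim_img a Q (lattice_of B)) <->
  rational_similarity B a Q.
Proof.
move=> Bu Qu a0; rewrite sim_img_lattice_of; split.
  apply: commensurate_lattice_of_rat => //.
  by rewrite unitmxZ ?unitfE // unitmx_mul Qu.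
by case=> M Mu; exact: commensurate_lattice_of.
Qed.

Lemma rational_similarity1 B : rational_similarity B 1 1%:M.
Proof. by exists 1%:M; rewrite ?unitmx1 // map_mx1 mulmx1 mul1mx scale1r. Qed.

Lemma rational_similarityM B a b P Q : rational_similarity B a P ->
  rational_similarity B b Q -> rational_similarity B (a * b) (P *m Q).
Proof.
move=> [M Mu ME] [N Nu NE]; exists (M *m N); first by rewrite unitmx_mul Mu.
by rewrite map_mxM mulmxA -ME -scalemxAl -!mulmxA -NE -scalemxAr scalerA.
Qed.

Lemma rational_similarityV B a Q : a != 0 -> Q \in unitmx ->
  rational_similarity B a Q -> rational_similarity B a^-1 (invmx Q).
Proof.
move=> a0 Qu [M Mu ME]; exists (invmx M); first by rewrite unitmx_inv.
have Mu' : map_mx (ratr : rat -> R) M \in unitmx by rewrite map_unitmx.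
rewrite map_invmx; apply: (can_inj (mulmxK Mu')); rewrite mulmxKV //.
rewrite -!scalemxAl -mulmxA -ME -scalemxAr mulmxA.
by rewrite mulVmx // mul1mx scalerA mulVf // scale1r.
Qed.

Lemma rational_similarityZ B a Q (q : rat) : q != 0 ->
  rational_similarity B a Q -> rational_similarity B (ratr q * a) Q.
Proof.
move=> q0 [M Mu ME]; exists (q *: M); first by rewrite unitmxZ ?unitfE.
by rewrite map_mxZ -scalemxAr -ME scalerA.
Qed.

(** Cancelling B leaves a I = M, and a is read off a diagonal entry, which exists because d > 0. *)
Lemma rational_similarity_scalar B a : (0 < d)%N -> B \in unitmx ->
  rational_similarity B a 1%:M -> exists q : rat, a = ratr q.
Proof.
move=> d0 Bu [M _]; rewrite mul1mx => ME.
have {}ME : a%:M = map_mx ratr M.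
  by apply: (can_inj (mulKmx Bu)); rewrite -ME mul_mx_scalar.
pose i := Ordinal d0; exists (M i i).
by have /matrixP/(_ i i) := ME; rewrite !mxE eqxx.
Qed.

(** Composing the similarity of factor a with the inverse of that of factor b gives the identity
    with factor a / b. *)
Lemma rational_similarity_ratio B a b Q : (0 < d)%N -> B \in unitmx ->
  Q \in unitmx -> b != 0 -> rational_similarity B a Q ->
  rational_similarity B b Q -> exists q : rat, a / b = ratr q.
Proof.
move=> d0 Bu Qu b0 ra rb; apply: (rational_similarity_scalar d0 Bu).
by rewrite -(mulmxV Qu); exact/rational_similarityM/rational_similarityV.
Qed.

Lemma rational_similarity_expn B a Q : B \in unitmx -> \det Q = 1 ->
  rational_similarity B a Q -> exists q : rat, a ^+ d = ratr q.
Proof.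
move=> Bu Q1 [M _ /(congr1 determinant)].
rewrite detZ !det_mulmx Q1 mul1r det_map_mx mulrC => /(mulfI _) E.
by exists (\det M); apply: E; rewrite -unitfE -unitmxE.
Qed.

(** * Rotations, and [SOC] and [SOS] in terms of rational similarity *)

Lemma is_rotation_unitmx Q : is_rotation Q -> Q \in unitmx.
Proof. by case=> QQ _; case: (mulmx1_unit QQ). Qed.

Lemma is_rotation1 : is_rotation (1%:M : 'M[R]_d).
Proof. by split; rewrite ?trmx1 ?mulmx1 ?det1. Qed.

Lemma is_rotationM P Q : is_rotation P -> is_rotation Q -> is_rotation (P *m Q).
Proof.
move=> [PP P1] [QQ Q1]; split; last by rewrite det_mulmx P1 Q1 mulr1.
by rewrite trmx_mul mulmxA -(mulmxA P) QQ mulmx1.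
Qed.

Lemma is_rotationV Q : is_rotation Q -> is_rotation (invmx Q).
Proof.
move=> rQ; have Qu := is_rotation_unitmx rQ; case: rQ => QQ Q1.
have -> : invmx Q = Q^T by rewrite -[LHS]mulmx1 -QQ mulKmx.
by split; rewrite ?det_tr // trmxK; exact: mulmx1C.
Qed.

Lemma SOC_lattice_of B Q : B \in unitmx ->
  SOC (lattice_of B) Q <-> is_rotation Q /\ rational_similarity B 1 Q.
Proof.
move=> Bu; rewrite /SOC rot_imgE.
by split=> -[rQ h]; split=> //;
  apply/(commensurate_sim_img Bu (is_rotation_unitmx rQ) (oner_neq0 _)).
Qed.

Lemma SOS_lattice_of B Q : B \in unitmx ->
  SOS (lattice_of B) Q <->
  is_rotation Q /\ exists2 a : R, 0 < a & rational_similarity B a Q.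
Proof.
move=> Bu.
split=> [[rQ [a [a0 h]]]|[rQ [a a0 h]]]; split=> //; exists a => //.
  exact/(commensurate_sim_img Bu (is_rotation_unitmx rQ) (lt0r_neq0 a0)).
split=> //.
exact/(commensurate_sim_img Bu (is_rotation_unitmx rQ) (lt0r_neq0 a0)).
Qed.

End LatticeCommensurability.

(** * The group of scaling factors modulo rationals *)

Section ScaleGroup.
Variables (R : realType) (d : nat) (B : 'M[R]_d).

(** Logarithms turn the multiplicative group of scaling factors into an additive one, to which the
    decomposition of abelian groups applies. *)
Definition log_scale : {pred R} :=
  fun x => `[< exists2 Q, is_rotation Q & rational_similarity B (expR x) Q >].

Fact log_scale_zmod_closed : zmod_closed log_scale.
Proof.
split.
  apply/asboolP; exists 1%:M; first exact: is_rotation1.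
  by rewrite expR0; exact: rational_similarity1.
move=> x y /asboolP[P rP xP] /asboolP[Q rQ yQ]; apply/asboolP.
exists (P *m invmx Q); first exact/is_rotationM/is_rotationV.
rewrite expRD expRN; apply: rational_similarityM => //.
by apply: rational_similarityV; rewrite ?is_rotation_unitmx // gt_eqF ?expR_gt0.
Qed.

HB.instance Definition _ :=
  GRing.isZmodClosed.Build R log_scale log_scale_zmod_closed.

Definition scale_group : Type := {x : R | x \in log_scale}.
HB.instance Definition _ := SubChoice.on scale_group.
HB.instance Definition _ := [SubChoice_isSubZmodule of scale_group by <:].

Definition rational_scale : {pred scale_group} :=
  fun u => `[< exists q : rat, expR (val u) = ratr q >].

Fact rational_scale_zmod_closed : zmod_closed rational_scale.
Proof.
split; first by apply/asboolP; exists 1; rewrite raddf0 expR0 rmorph1.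
move=> x y /asboolP[p pE] /asboolP[q qE]; apply/asboolP.
by exists (p / q); rewrite raddfB /= expRD expRN pE qE fmorph_div.
Qed.

HB.instance Definition _ :=
  GRing.isZmodClosed.Build scale_group rational_scale rational_scale_zmod_closed.

End ScaleGroup.

(** * The class of a similarity rotation modulo rational factors *)

Section ScaleQuotient.
Variables (R : realType) (d : nat) (B : 'M[R]_d).
Hypotheses (d_gt0 : (0 < d)%N) (Bu : B \in unitmx).

Let quotient := Quotient.quot (@rational_scale R d B).

Lemma pi_scale_eq (u v : scale_group B) :
  (exists q : rat, expR (val u) / expR (val v) = ratr q) <->
  \pi_quotient u = \pi_quotient v.
Proof.
rewrite -expRN -expRD -(raddfB (\val : scale_group B -> R)) /=.
split=> [h|/eqP]; first by apply/eqP; rewrite -Quotient.idealrBE; exact/asboolP.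
by rewrite -Quotient.idealrBE => /asboolP.
Qed.

(** A relation, since a rotation has many factors; it is single-valued on rotations by
    [scale_class_uniq]. *)
Definition scale_class (Q : 'M[R]_d) (v : quotient) :=
  exists2 u : scale_group B, rational_similarity B (expR (val u)) Q & v = \pi u.

Lemma scale_class_exists Q : SOS (lattice_of B) Q -> exists v, scale_class Q v.
Proof.
move=> /(SOS_lattice_of _ Bu)[rQ [a a0 aQ]].
have ln_a : ln a \in log_scale B by apply/asboolP; exists Q; rewrite // lnK.
pose u : scale_group B := Sub (ln a) ln_a.
by exists (\pi_quotient u), u; rewrite // SubK lnK.
Qed.

Lemma scale_class_surj v : exists2 Q, SOS (lattice_of B) Q & scale_class Q v.
Proof.
have /asboolP[Q rQ vQ] := valP (repr v).
exists Q; last by exists (repr v) => //; rewrite reprK.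
apply/(SOS_lattice_of _ Bu); split=> //.
by exists (expR (val (repr v))); rewrite ?expR_gt0.
Qed.

Lemma scale_class_uniq Q v w : is_rotation Q ->
  scale_class Q v -> scale_class Q w -> v = w.
Proof.
move=> rQ [u uQ ->] [t tQ ->]; apply/pi_scale_eq.
apply: rational_similarity_ratio uQ tQ => //; first exact: is_rotation_unitmx.
by rewrite gt_eqF ?expR_gt0.
Qed.

Lemma scale_classM P Q v w :
  scale_class P v -> scale_class Q w -> scale_class (P *m Q) (v + w).
Proof.
move=> [u uP ->] [t tQ ->]; exists (u + t); last by rewrite raddfD.
by rewrite raddfD expRD; exact: rational_similarityM.
Qed.

(** A trivial class means that the factor is a nonzero rational, which can be divided out. *)
Lemma scale_class0 Q : scale_class Q 0 <-> rational_similarity B 1 Q.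
Proof.
have pi0 : 0 = \pi_quotient 0 by rewrite raddf0.
split=> [[u uQ]|Q1]; last by exists 0; rewrite // raddf0 expR0.
rewrite pi0 => /esym/pi_scale_eq; rewrite raddf0 expR0 divr1 => -[q qE].
have q0 : q != 0.
  by apply/eqP => q0; have := expR_gt0 (val u); rewrite qE q0 rmorph0 ltxx.
have := rational_similarityZ (q := q^-1) _ uQ.
by rewrite qE -rmorphM mulVf // rmorph1 invr_eq0; exact.
Qed.

(** Every class comes from a rotation, and the d-th power of its factor is rational by
    determinants. *)
Lemma scale_quotient_torsion (v : quotient) : v *+ d = 0.
Proof.
have [Q /(SOS_lattice_of _ Bu)[[_ Q1] _] [u uQ ->]] := scale_class_surj v.
rewrite -raddfMn -(raddf0 \pi_quotient); apply/pi_scale_eq.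
rewrite raddf0 expR0 divr1 raddfMn -mulr_natl expRM_natl.
exact: rational_similarity_expn uQ.
Qed.

End ScaleQuotient.

Arguments scale_class {R d} B Q v.

(** * Normality, countability and decomposition of the factor group *)

Section Coincidence.
Variables (R : realType) (d : nat) (B : 'M[R]_d).
Hypotheses (d_gt0 : (0 < d)%N) (Bu : B \in unitmx).

Lemma SOC_normal_subgroup :
  normal_subgroup (SOC (lattice_of B)) (SOS (lattice_of B)).
Proof.
split.
- apply/(SOC_lattice_of _ Bu); split; first exact: is_rotation1.
  exact: rational_similarity1.
- move=> P Q /(SOC_lattice_of _ Bu)[rP P1] /(SOC_lattice_of _ Bu)[rQ Q1].
  apply/(SOC_lattice_of _ Bu); split; first exact: is_rotationM.
  by rewrite -[1]mulr1; exact: rational_similarityM.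
- move=> P /(SOC_lattice_of _ Bu)[rP P1].
  apply/(SOC_lattice_of _ Bu); split; first exact: is_rotationV.
  rewrite -invr1; apply: rational_similarityV => //; first exact: oner_neq0.
  exact: is_rotation_unitmx.
- move=> Q /(SOC_lattice_of _ Bu)[rQ Q1].
  by apply/(SOS_lattice_of _ Bu); split=> //; exists 1.
- move=> S Q /(SOS_lattice_of _ Bu)[rS [a a0 aS]] /(SOC_lattice_of _ Bu)[rQ Q1].
  apply/(SOC_lattice_of _ Bu); split.
    by apply: is_rotationM; [exact: is_rotationM|exact: is_rotationV].
  (* The factors of S, Q and the inverse of S multiply to a * 1 / a = 1. *)
  rewrite -(mulfV (lt0r_neq0 a0)) -[a in a / _]mulr1.
  apply: rational_similarityM; first exact: rational_similarityM.
  by apply: rational_similarityV; rewrite ?lt0r_neq0 ?is_rotation_unitmx.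
Qed.

Lemma SOC_quotient_countable :
  quotient_countable (SOC (lattice_of B)) (SOS (lattice_of B)).
Proof.
pose P (M : 'M[rat]_d) Q := is_rotation Q /\
  exists2 a : R, 0 < a & a *: (Q *m B) = B *m map_mx ratr M /\ M \in unitmx.
have PG M Q : P M Q -> SOS (lattice_of B) Q.
  case=> rQ [a a0 [aM Mu]]; apply/(SOS_lattice_of _ Bu); split=> //.
  by exists a => //; exists M.
(* Each n is decoded as a rational matrix; f n is a rotation realising that matrix if there is one,
   and the identity otherwise. *)
have /choice[f fP] (n : nat) : exists Q', SOS (lattice_of B) Q' /\
    forall M Q, unpickle n = Some M -> P M Q -> P M Q'.
  case E : (unpickle n) => [M|]; last first.
    exists 1%:M; split=> //; have [C1 _ _ CS _] := SOC_normal_subgroup.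
    exact: CS.
  case: (pselect (exists Q, P M Q)) => [[Q PQ]|nQ].
    by exists Q; split; [exact: PG PQ|move=> M' Q' [<-] _].
  exists 1%:M; split; last by move=> M' Q [<-] PQ; case: nQ; exists Q.
  have [C1 _ _ CS _] := SOC_normal_subgroup; exact: CS.
exists f; split=> [n|S]; first by case: (fP n).
move=> /(SOS_lattice_of _ Bu)[rS [a a0 [M Mu aM]]].
(* Q and S share the rational matrix M, so they are proportional; both have
   determinant 1 and the factor is positive, so they are equal. *)
exists (pickle M).
have [|[Q1' Q1] [b b0 [bM _]]] := (fP (pickle M)).2 M S (pickleK M).
  by split=> //; exists a.
set Q := f _ in Q1' Q1 bM *.
have Qu : Q \in unitmx by exact: is_rotation_unitmx.
have SE : S = (b / a) *: Q.
  apply: (can_inj (mulmxK Bu)); apply: (scalerI (lt0r_neq0 a0)).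
  by rewrite aM -bM -scalemxAl scalerA mulrC divfK // lt0r_neq0.
have ba0 : 0 < b / a by exact: divr_gt0.
have /eqP : (b / a) ^+ d = 1.
  by case: rS => _ <-; rewrite SE detZ Q1 mulr1.
rewrite pexpr_eq1 ?ltW // => /eqP ba1.
rewrite SE ba1 scale1r mulVmx //.
by have [] := SOC_normal_subgroup.
Qed.

Lemma SOC_quotient_direct_sum_cyclic :
  quotient_direct_sum_cyclic (SOC (lattice_of B)) (SOS (lattice_of B)).
Proof.
have [I [n [phi [nP phi0 phiD phi_inj phi_surj]]]] :=
  bounded_group_direct_sum_cyclic d_gt0 (scale_quotient_torsion Bu).
(* The class of Q, with default value 0 outside [SOS]. *)
have /choice[psi psiP] Q : exists v, SOS (lattice_of B) Q -> scale_class B Q v.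
  case: (pselect (SOS (lattice_of B) Q)) => [h|]; last by exists 0.
  by have [v vQ] := scale_class_exists Bu h; exists v.
have psi_uniq Q v : SOS (lattice_of B) Q -> scale_class B Q v -> psi Q = v.
  move=> SQ; have [rQ _] := (SOS_lattice_of _ Bu).1 SQ.
  exact: (scale_class_uniq d_gt0 Bu rQ (psiP _ SQ)).
exists I, n, (fun Q => phi (psi Q)); split=> //.
- by move=> S _; have [s sP] := phi0 (psi S); exists s => i /sP ->.
- move=> S T hS hT i; rewrite -phiD; congr (phi _ i %% _)%Z.
  apply: psi_uniq; last by apply: scale_classM; exact: psiP.
  have [rS [a a0 aS]] := (SOS_lattice_of _ Bu).1 hS.
  have [rT [b b0 bT]] := (SOS_lattice_of _ Bu).1 hT.
  apply/(SOS_lattice_of _ Bu); split; first exact: is_rotationM.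
  by exists (a * b); [exact: mulr_gt0|exact: rational_similarityM].
- move=> S hS; have [rS _] := (SOS_lattice_of _ Bu).1 hS.
  split=> [/(SOC_lattice_of _ Bu)[_ S1] i|/phi_inj psi0].
    have -> : psi S = 0 by apply: psi_uniq => //; exact/scale_class0.
    (* Additivity at 0 + 0 shows that [phi 0 i] is 0 modulo [n i]. *)
    have := phiD 0 0 i; rewrite addr0 => /eqP.
    by rewrite -{1}[phi 0 i]addr0 eqz_modDl eq_sym => /eqP.
  apply/(SOC_lattice_of _ Bu); split=> //; apply/scale_class0.
  by rewrite -psi0; exact: psiP.
- move=> g /phi_surj[v vg]; have [S hS Sv] := scale_class_surj Bu v.
  by exists S; split=> // i; rewrite (psi_uniq _ _ hS Sv).
Qed.

End Coincidence.

Theorem mainTheorem3 (R : realType) (d : nat) (L : 'cV[R]_d -> Prop) :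
  (2 <= d)%N -> is_lattice L ->
  [/\ normal_subgroup (SOC L) (SOS L),
      quotient_countable (SOC L) (SOS L) &
      quotient_direct_sum_cyclic (SOC L) (SOS L)].
Proof.
move=> /ltnW d_gt0 /is_lattice_lattice_of[B Bu ->]; split.
- exact: SOC_normal_subgroup.
- exact: SOC_quotient_countable.
- exact: SOC_quotient_direct_sum_cyclic.
Qed.
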